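(* Let $n\ge2$ and let $\chi=(P_1,\ldots,P_{n+1})$ be a homogeneous degree $m\ge3$ vector field on $\mathbb{S}^n$. Let $j\in\{1,\ldots,n+1\}$ and suppose that $\chi$ has an invariant $(n-1)$-sphere $\{x_j+d=0\}\cap\mathbb{S}^n$ with $0<|d|<1$. Then $$P_j=\Big(\sum_{i=1,\,i\ne j}^{n+1}B_ix_i\Big)\Big(x_j^2-d^2\sum_{i=1}^{n+1}x_i^2\Big),$$ where the $B_i\in\mathbb{R}[x_1,\ldots,x_{n+1}]$ are polynomials of degree at most $m-3$.
   Context: $\mathbb{S}^n=\{x\in\mathbb{R}^{n+1} : \sum_i x_i^2=1\}$. A polynomial vector field $\chi=(P_1,\ldots,P_{n+1})$ in $\mathbb{R}^{n+1}$ is identified with the operator $\sum_i P_i\,\partial/\partial x_i$; its degree is $\max_i\deg P_i$, and it is homogeneous if the $P_i$ are homogeneous polynomials of the same degree. It is a vector field on $\mathbb{S}^n$ if $\chi(\sum_i x_i^2-1)=K(\sum_i x_i^2-1)$ for some real polynomial $K$. A subset of $\mathbb{R}^{n+1}$ is invariant for $\chi$ if it is a union of trajectories of $\chi$. An $(n-1)$-sphere in $\mathbb{S}^n$ is an intersection $\{\sum_i a_ix_i+b=0\}\cap\mathbb{S}^n$ with $\sum_i a_i^2=1$, $|b|<1$. *)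

(* Defs.v *)
(* mpoly has to be imported before the MathComp-Analysis files: their notations
   clash when imported in the opposite order. *)
From mathcomp Require Import all_boot all_order all_algebra.
From mathcomp Require Import mpoly.
From mathcomp Require Import boolp classical_sets reals.
From mathcomp Require Import topology normedtype derive.
Import numFieldNormedType.Exports.

Set Implicit Arguments.
Unset Strict Implicit.
Unset Printing Implicit Defensive.

Import Order.TTheory GRing.Theory Num.Theory.

Local Open Scope classical_set_scope.
Local Open Scope ring_scope.

Section PolynomialVectorFields.
Variables (R : realType) (k : nat).
Implicit Types (P : 'I_k -> {mpoly R[k]}) (A : set 'rV[R]_k).

(* [msize p] is the total degree plus one; the zero polynomial gets degree 0. *)
Definition mpoly_deg (p : {mpoly R[k]}) : nat := (msize p).-1.

(* A polynomial vector field on R^k is given by the family P of its k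
   components. *)

Definition vf_deg P : nat := \max_(i < k) mpoly_deg (P i).

Definition vf_homogeneous P : Prop :=
  exists e : nat, forall i : 'I_k, P i \is e.-homog for mdeg.

Definition vf_apply P (f : {mpoly R[k]}) : {mpoly R[k]} :=
  \sum_(i < k) P i * f^`M(i).

Definition vf_eval P (x : 'rV[R]_k) : 'rV[R]_k :=
  \row_(i < k) (P i).@[fun l : 'I_k => x ord0 l].

Definition unit_sphere : set 'rV[R]_k :=
  [set x | \sum_(i < k) x ord0 i ^+ 2 = 1].

Definition sphere_poly : {mpoly R[k]} := \sum_(i < k) 'X_i ^+ 2 - 1.

Definition vf_on_sphere P : Prop :=
  exists K : {mpoly R[k]}, vf_apply P sphere_poly = K * sphere_poly.

(* The function c is total, but only its values on the open interval I are
   meaningful. *)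
Definition is_solution P (I : set R) (c : R -> 'rV[R]_k) : Prop :=
  [/\ open I, is_interval I, I !=set0 &
      forall t : R, I t -> is_derive t (1 : R) c (vf_eval P (c t))].

Definition is_maximal_solution P (I : set R) (c : R -> 'rV[R]_k) : Prop :=
  is_solution P I c /\
  forall (J : set R) (c' : R -> 'rV[R]_k), is_solution P J c' ->
    I `<=` J -> (forall t : R, I t -> c' t = c t) -> J = I.

Definition is_trajectory P A : Prop :=
  exists (I : set R) (c : R -> 'rV[R]_k),
    is_maximal_solution P I c /\ A = c @` I.

Definition vf_invariant P A : Prop :=
  exists F : set (set 'rV[R]_k),
    (forall T : set 'rV[R]_k, F T -> is_trajectory P T) /\
    A = \bigcup_(T in F) T.

End PolynomialVectorFields.

Arguments unit_sphere {R k}.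

(* Main.v *)
Require Import Defs.
From mathcomp Require Import all_boot all_order all_algebra.
From mathcomp Require Import ring lra zify.
From mathcomp Require Import mpoly.
From mathcomp Require Import boolp classical_sets reals.
From mathcomp Require Import topology normedtype derive.
Import numFieldNormedType.Exports.
Import Order.TTheory GRing.Theory Num.Theory.

Local Open Scope classical_set_scope.
Local Open Scope ring_scope.

(** Write S for the section x_j = -d of the unit sphere, q for the quadratic
    form x_j^2 - d^2 |x|^2 and e_j for the j-th vector of the standard basis.

    A trajectory inside S has constant j-th coordinate, so its velocity there
    has j-th component 0: P_j vanishes on S ([invariant_hyperplane_section]).
    As P_j is homogeneous it vanishes on the cone over S, which is the zero set
    of q ([homog_vanishes_on_cone]).  Up to the factor 1 - d^2 > 0, q is
    x_j^2 - c with c a positive multiple of the sum of the other squares.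
    Divide P_j by this polynomial, monic in x_j: the remainder a x_j + b
    vanishes at both square roots x_j = sqrt c and x_j = - sqrt c, which forces
    a = b = 0 ([monic_quadratic_dvd]).  Hence P_j = Q q ([cone_poly_dvd]).

    It remains to see that Q has no monomial in x_j alone.  The field is
    tangent to the sphere at e_j ([vf_on_sphere_tangent]), so P_j(e_j) = 0 and,
    by homogeneity, P_j vanishes on the j-th axis.  Since q(e_j) = 1 - d^2 is
    nonzero, Q vanishes on this axis off the origin, so its part g that
    involves only x_j is 0 ([mpoly_mod_other_variables]).  The degree bounds
    follow from deg P_j = deg Q + 2 when Q is nonzero.

    Independence of a polynomial from some of the variables is expressed
    through its values, and identities between polynomials are obtained from
    identities between values ([mpoly_eq0_meval]). *)

(** * Polynomials and their values *)

(** Monomials are distinct characters of the multiplicative monoid R^n, and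
    the proof is Artin's argument for the independence of characters: rescale
    one variable on which two monomials differ and subtract, which removes the
    first monomial from the relation and multiplies the other coefficients by
    known factors. *)
Lemma monomials_linear_independent {R : numDomainType} {n : nat}
    (s : seq 'X_{1..n}) (c : 'X_{1..n} -> R) :
  uniq s ->
  (forall v : 'I_n -> R, \sum_(m <- s) c m * \prod_i v i ^+ m i = 0) ->
  {in s, forall m, c m = 0}.
Proof.
elim: s c => [|m0 s IHs] c //= /andP[m0s us] c0.
have cs : {in s, forall m, c m = 0}.
  move=> m ms.
  have [i mi] : exists i, m i != m0 i.
    apply/existsP; rewrite -negb_forall; apply: contra m0s => /forallP e.
    by have <- : m = m0 by apply/mnmP => i; exact/eqP.
  (* Doubling the variable i multiplies the monomial m by 2 ^+ m i, so the
     relation at the rescaled point minus 2 ^+ m0 i times the relation at v no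
     longer involves m0. *)
  suff /eqP : c m * (2 ^+ m i - 2 ^+ m0 i) = 0.
    rewrite mulf_eq0 subr_eq0 => /orP[/eqP//|/eqP e].
    have n21 : (2 : R) != 1 by rewrite (eqr_nat R 2 1).
    by rewrite (ieexprIn (ltr0Sn R 1) n21 e) eqxx in mi.
  move: m ms {mi}; apply: (IHs (fun m => c m * (2 ^+ m i - 2 ^+ m0 i))) => // v.
  pose w k := if k == i then 2 * v k else v k.
  have wE m : \prod_k w k ^+ m k = 2 ^+ m i * \prod_k v k ^+ m k.
    rewrite (bigD1 i)//= [in RHS](bigD1 i)//= /w eqxx exprMn !mulrA.
    by congr (_ * _); apply: eq_bigr => k /negPf ->.
  have := c0 w; have := c0 v; rewrite !big_cons wE => e1 e2.
  under eq_bigr do rewrite mulrBr mulrBl.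
  rewrite sumrB.
  have e3 : \sum_(m <- s) c m * 2 ^+ m i * \prod_k v k ^+ m k =
            \sum_(m <- s) c m * \prod_k w k ^+ m k.
    by apply: eq_bigr => m _; rewrite wE mulrA.
  have e4 : \sum_(m <- s) c m * 2 ^+ m0 i * \prod_k v k ^+ m k =
            2 ^+ m0 i * \sum_(m <- s) c m * \prod_k v k ^+ m k.
    by rewrite mulr_sumr; apply: eq_bigr => m _; ring.
  rewrite e3 e4 (canRL (addKr _) e1) (canRL (addKr _) e2); ring.
move=> m; rewrite inE => /orP[/eqP ->|/cs//].
have := c0 (fun=> 1); rewrite big_cons.
rewrite [X in _ + X]big_seq [X in _ + X]big1 => [|k ks]; last first.
  by rewrite cs ?mul0r.
by rewrite addr0 big1 ?mulr1// => i _; rewrite expr1n.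
Qed.

Lemma mpoly_eq0_meval {R : numDomainType} {n : nat} (p : {mpoly R[n]}) :
  (forall v, p.@[v] = 0) -> p = 0.
Proof.
move=> p0; apply/mpolyP => m; rewrite mcoeff0.
have [mp|/memN_msupp_eq0//] := boolP (m \in msupp p).
apply: (monomials_linear_independent _ (fun m => p@_m) (msupp_uniq p)) mp => v.
by rewrite -mevalE.
Qed.

Lemma mevalXUn {R : comNzRingType} {n k : nat} (i : 'I_n) (v : 'I_n -> R) :
  ('X_i ^+ k).@[v] = v i ^+ k.
Proof. by rewrite rmorphXn/= mevalXU. Qed.

Lemma meval_sum_sqr {R : comNzRingType} {n : nat} (D : pred 'I_n) v :
  (\sum_(i < n | D i) 'X_i ^+ 2 : {mpoly R[n]}).@[v] = \sum_(i < n | D i) v i ^+ 2.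
Proof. by rewrite raddf_sum; apply: eq_bigr => i _; exact: mevalXUn. Qed.

Lemma mderivXU {R : nzRingType} {n : nat} (i l : 'I_n) :
  ('X_l : {mpoly R[n]})^`M(i) = (l == i)%:R.
Proof.
rewrite mderivX mnm1E; case: eqP => [->|_]; last by rewrite scale0r.
by rewrite scale1r -{1}[U_(i)%MM]add0m addmK mpolyX0.
Qed.

Lemma meval_homog_scale {R : comNzRingType} {n d : nat} {p : {mpoly R[n]}} t v :
  p \is d.-homog -> p.@[fun i => t * v i] = t ^+ d * p.@[v].
Proof.
move=> /dhomogP ph; rewrite !mevalE mulr_sumr big_seq [RHS]big_seq.
apply: eq_bigr => m mp; rewrite mulrCA; congr (_ * _).
under eq_bigr do rewrite exprMn.
by rewrite big_split/= prodrXr -mdegE [mdeg m](ph m mp).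
Qed.

Lemma msize_homog_le {R : nzRingType} {n d : nat} {p : {mpoly R[n]}} :
  p \is d.-homog -> (msize p <= d.+1)%N.
Proof.
by move=> /dhomogP ph; rewrite mmeasureE; apply/bigmax_leqP_seq => m /ph ->.
Qed.

(** * Division by a quadratic polynomial monic in one variable *)

(** Independence is stated on values, so that it is preserved by the ring
    operations for immediate reasons and can be used directly to change the
    j-th coordinate of a point. *)
Definition free_of {R : nzRingType} {n} (j : 'I_n) (p : {mpoly R[n]}) :=
  forall v w : 'I_n -> R, (forall i, i != j -> v i = w i) -> p.@[v] = p.@[w].

(** The polynomials that have such a quotient and remainder form a subring: in
    a product, the term in 'X_j ^+ 2 is replaced with c modulo the divisor.
    This subring contains the constants and the variables. *)
Lemma mpoly_div_monic_quadratic {R : comNzRingType} {n : nat} {j : 'I_n}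
    {c : {mpoly R[n]}} (p : {mpoly R[n]}) : free_of j c ->
  exists Q a b, [/\ free_of j a, free_of j b &
    p = Q * ('X_j ^+ 2 - c) + (a * 'X_j + b)].
Proof.
move=> cj; pose D p := exists Q a b, [/\ free_of j a, free_of j b &
    p = Q * ('X_j ^+ 2 - c) + (a * 'X_j + b)].
have free_const (k : R) : free_of j (k%:MP_[n]) by move=> v w _; rewrite !mevalC.
have DC k : D k%:MP.
  exists 0, 0, k%:MP; split => //; last by rewrite !mul0r !add0r.
  by rewrite -[0]mpolyC0.
have DX i : D 'X_i.
  have [->|ij] := eqVneq i j.
    by exists 0, 1%:MP, 0%:MP; split => //; rewrite mpolyC0 mpolyC1; ring.
  exists 0, 0%:MP, 'X_i; split => //; last by rewrite mpolyC0; ring.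
  by move=> v w vw; rewrite !mevalXU vw.
have DD p1 p2 : D p1 -> D p2 -> D (p1 + p2).
  move=> [Q1 [a1 [b1 [ha1 hb1 ->]]]] [Q2 [a2 [b2 [ha2 hb2 ->]]]].
  exists (Q1 + Q2), (a1 + a2), (b1 + b2); split; last ring.
  - by move=> v w vw; rewrite !mevalD (ha1 v w) ?(ha2 v w).
  - by move=> v w vw; rewrite !mevalD (hb1 v w) ?(hb2 v w).
have DM p1 p2 : D p1 -> D p2 -> D (p1 * p2).
  move=> [Q1 [a1 [b1 [ha1 hb1 ->]]]] [Q2 [a2 [b2 [ha2 hb2 ->]]]].
  exists (Q1 * (Q2 * ('X_j ^+ 2 - c) + (a2 * 'X_j + b2)) +
          (a1 * 'X_j + b1) * Q2 + a1 * a2),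
    (a1 * b2 + a2 * b1), (b1 * b2 + a1 * a2 * c); split; last ring.
  - move=> v w vw; rewrite !(mevalD, mevalM).
    by rewrite (ha1 v w) ?(ha2 v w) ?(hb1 v w) ?(hb2 v w).
  - move=> v w vw; rewrite !(mevalD, mevalM).
    by rewrite (ha1 v w) ?(ha2 v w) ?(hb1 v w) ?(hb2 v w) ?(cj v w).
rewrite -/(D p); elim/mpolyind: p => [|k m p _ _ Dp]; first by rewrite -mpolyC0.
apply: DD => //; rewrite -mul_mpolyC; apply: (DM) => //.
rewrite mpolyXE_id; apply: big_ind => [||i _]; [by rewrite -mpolyC1|exact: DM|].
elim: (m i) => [|e IH]; first by rewrite expr0 -mpolyC1.
by rewrite exprS; exact: DM.
Qed.

(** At a point with given other coordinates, the remainder a * 'X_j + b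
    vanishes for both values of x_j whose square is c.  Half the sum and half
    the difference show that b and a * sqrt c vanish everywhere; the case
    c = 0 at some points is absorbed by concluding that a * c = 0. *)
Lemma monic_quadratic_dvd {R : rcfType} {n : nat} {j : 'I_n}
    {c p : {mpoly R[n]}} :
  free_of j c -> c != 0 -> (forall v, 0 <= c.@[v]) ->
  (forall v, v j ^+ 2 = c.@[v] -> p.@[v] = 0) ->
  exists Q, p = Q * ('X_j ^+ 2 - c).
Proof.
move=> cj c0 cge0 p0.
have [Q [a [b [aj bj pE]]]] := mpoly_div_monic_quadratic p cj.
have rem0 v y : y ^+ 2 = c.@[v] -> a.@[v] * y + b.@[v] = 0.
  move=> yc; pose w i := if i == j then y else v i.
  have vw i : i != j -> v i = w i by rewrite /w => /negPf ->.
  have wj : w j = y by rewrite /w eqxx.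
  have wc : w j ^+ 2 = c.@[w] by rewrite wj yc; exact: cj.
  have := p0 w wc; rewrite pE mevalD mevalM mevalB mevalXUn wc subrr mulr0 add0r.
  by rewrite mevalD mevalM mevalXU wj -(aj v w)// -(bj v w).
have ab v : a.@[v] * Num.sqrt c.@[v] = 0 /\ b.@[v] = 0.
  have e1 := rem0 v _ (sqr_sqrtr (cge0 v)).
  have := rem0 v (- Num.sqrt c.@[v]); rewrite sqrrN sqr_sqrtr// => /(_ erefl) e2.
  by split; lra.
have b0 : b = 0 by apply: mpoly_eq0_meval => v; case: (ab v).
have : a * c = 0.
  apply: mpoly_eq0_meval => v; rewrite mevalM -(sqr_sqrtr (cge0 v)) expr2 mulrA.
  by case: (ab v) => -> _; rewrite mul0r.
move/eqP; rewrite mulf_eq0 (negPf c0) orbF => /eqP a0.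
by exists Q; rewrite pE a0 b0; ring.
Qed.

(** * Reduction to one axis *)

(** Sort the monomials of p: one that contains some variable other than 'X_j is
    divided by such a variable, which lowers its degree by one, and the others
    are collected in g. *)
Lemma mpoly_mod_other_variables {R : comNzRingType} {n : nat} (j : 'I_n)
    (p : {mpoly R[n]}) :
  exists (B : 'I_n -> {mpoly R[n]}) (g : {mpoly R[n]}),
  [/\ forall i, (msize (B i) <= (msize p).-1)%N,
      forall v w, v j = w j -> g.@[v] = g.@[w] &
      p = \sum_(i < n | i != j) B i * 'X_i + g].
Proof.
pose D k p := exists (B : 'I_n -> {mpoly R[n]}) (g : {mpoly R[n]}),
  [/\ forall i, (msize (B i) <= k)%N,
      forall v w, v j = w j -> g.@[v] = g.@[w] &
      p = \sum_(i < n | i != j) B i * 'X_i + g].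
rewrite -/(D (msize p).-1 p); set k := (msize p).-1.
have DD p1 p2 : D k p1 -> D k p2 -> D k (p1 + p2).
  move=> [B1 [g1 [s1 h1 ->]]] [B2 [g2 [s2 h2 ->]]].
  exists (fun i => B1 i + B2 i), (g1 + g2); split.
  - move=> i; apply: leq_trans (mmeasureD_le _ _ _) _.
    by rewrite geq_max s1 s2.
  - by move=> v w vw; rewrite !mevalD (h1 v w) ?(h2 v w).
  - by under [in RHS]eq_bigr do rewrite mulrDl; rewrite big_split/=; ring.
have D0 : D k 0.
  exists (fun=> 0), 0; split => [i|v w _|]; rewrite ?mmeasure0 ?meval0//.
  by rewrite big1 ?addr0// => i _; rewrite mul0r.
rewrite (mpolyE p) big_seq; apply: big_ind => // m mp.
have [/existsP[i /andP[ij mi]]|] := boolP [exists i, (i != j) && (m i != 0%N)].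
  exists (fun l => if l == i then p@_m *: 'X_[m - U_(i)] else 0), 0; split.
  - move=> l; case: eqP => _; last by rewrite mmeasure0.
    apply: leq_trans (mmeasureZ_le _ _ _) _; rewrite msizeX.
    have := msize_mdeg_lt mp.
    rewrite /k -[in mdeg m](submK (m := U_(i)%MM) (m' := m)) ?lep1mP//.
    by rewrite mdegD mdeg1 addn1; case: (msize p).
  - by move=> v w _; rewrite !meval0.
  - rewrite (bigD1 i)//= eqxx big1 => [|l /andP[_ /negPf ->]]; last by rewrite mul0r.
    by rewrite !addr0 -scalerAl -mpolyXD submK ?lep1mP.
rewrite negb_exists => /forallP m0.
exists (fun=> 0), (p@_m *: 'X_[m]); split => [i|v w vw|].
- by rewrite mmeasure0.
- rewrite !mevalZ !mevalX; congr (_ * _); apply: eq_bigr => i _.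
  by have := m0 i; have [->|ij] := eqVneq i j; rewrite ?vw//= negbK => /eqP ->.
- by rewrite big1 ?add0r// => i _; rewrite mul0r.
Qed.

(** * Vector fields on the sphere *)

(** Through each point of A passes a solution that stays in A, hence keeps its
    j-th coordinate constant on an open interval; the derivative of that
    coordinate is the value of P j. *)
Lemma invariant_hyperplane_section {R : realType} {k : nat}
    {P : 'I_k -> {mpoly R[k]}} {j : 'I_k} {a : R} {A : set 'rV[R]_k} :
  vf_invariant P A -> (forall x, A x -> x ord0 j = a) ->
  forall x, A x -> (P j).@[fun i => x ord0 i] = 0.
Proof.
move=> [F [Ftraj AE]] Aa x Ax.
have [T FT Tx] : (\bigcup_(T in F) T) x by rewrite -AE.
have [I [c [[[oI _ _ cI] _] TE]]] := Ftraj T FT.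
move: Tx; rewrite TE => -[t It ctx].
have [cder cval] := cI t It.
have cj s : I s -> c s ord0 j = a.
  by move=> Is; apply: Aa; rewrite AE; exists T => //; rewrite TE; exists s.
have dj0 : 'D_1 (fun s => c s ord0 j) t = 0.
  rewrite (near_eq_derive (g := fun=> a)) ?derive_cst//.
  have : nbhs t I by exact: open_nbhs_nbhs.
  by apply: filterS => s /cj.
have := congr1 (fun M : 'rV_k => M ord0 j) cval.
by rewrite derive_mx// !mxE dj0 ctx.
Qed.

Lemma mderiv_sphere_poly (R : realType) (k : nat) (i : 'I_k) :
  (sphere_poly R k)^`M(i) = 'X_i *+ 2.
Proof.
have dX (l : 'I_k) :
    ('X_l ^+ 2 : {mpoly R[k]})^`M(i) = ((l == i)%:R *+ 2) * 'X_l.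
  by rewrite expr2 mderivM mderivXU; ring.
rewrite /sphere_poly mderivB -mpolyC1 mderivC subr0.
rewrite [LHS](raddf_sum (mderiv i)) (bigD1 i)//= dX eqxx.
rewrite big1 => [|l /negPf li]; first by rewrite addr0 mulr_natl.
by rewrite dX li mul0rn mul0r.
Qed.

(** The field applied to the equation of the sphere is twice the scalar product
    of the field with the position vector, and it vanishes where the equation
    does. *)
Lemma vf_on_sphere_tangent {R : realType} {k : nat} {P : 'I_k -> {mpoly R[k]}} :
  vf_on_sphere P -> forall v : 'I_k -> R,
  \sum_i v i ^+ 2 = 1 -> \sum_i (P i).@[v] * v i = 0.
Proof.
move=> [K PK] v v1; have := congr1 (meval v) PK.
rewrite mevalM [(sphere_poly R k).@[v]]mevalB meval1 meval_sum_sqr v1 subrr mulr0.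
rewrite /vf_apply raddf_sum => PK0.
suff /eqP : 2 * \sum_i (P i).@[v] * v i = 0.
  by rewrite mulf_eq0 pnatr_eq0 => /eqP.
rewrite -[RHS]PK0 mulr_sumr; apply: eq_bigr => i _.
by rewrite [RHS]mevalM mderiv_sphere_poly mevalMn mevalXU; ring.
Qed.

(** A point v of the cone off the origin is t times a point of the sphere whose
    j-th coordinate is - d.  The scale t = - v_j / d carries a sign, so both
    nappes of the cone are reached.  At the origin p vanishes because its
    degree is positive. *)
Lemma homog_vanishes_on_cone {R : realFieldType} {k e : nat} {j : 'I_k} {d : R}
    {p : {mpoly R[k]}} :
  p \is e.-homog -> (0 < e)%N -> d != 0 ->
  (forall v, v j = - d -> \sum_i v i ^+ 2 = 1 -> p.@[v] = 0) ->
  forall v, v j ^+ 2 = d ^+ 2 * \sum_i v i ^+ 2 -> p.@[v] = 0.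
Proof.
move=> ph e0 d0 p0 v vj; pose t := - v j / d.
have vt : v j = - d * t by rewrite /t; field.
have t2 : \sum_i v i ^+ 2 = t ^+ 2.
  have /mulfI : d ^+ 2 != 0 by rewrite expf_neq0.
  by apply; rewrite -vj vt; ring.
have [t0|t0] := eqVneq t 0.
  have v0 i : v i = 0.
    apply/eqP; rewrite -sqrf_eq0; move: t2; rewrite t0 expr0n/= => /eqP.
    rewrite psumr_eq0 => [/allP/(_ i)|? _]; last exact: sqr_ge0.
    by rewrite mem_index_enum => /(_ isT).
  rewrite (meval_eq (v2 := fun i => 0 * v i)) => [|i]; last by rewrite v0 mul0r.
  by rewrite (meval_homog_scale _ _ ph) expr0n gtn_eqF// mul0r.
rewrite (meval_eq (v2 := fun i => t * (v i / t))) => [|i]; last first.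
  by rewrite mulrC divfK.
rewrite (meval_homog_scale _ _ ph) p0 ?mulr0 ?vt ?mulfK//.
under eq_bigr do rewrite expr_div_n.
by rewrite -mulr_suml t2 divff// expf_neq0.
Qed.

(** Solved for x_j, the equation of the cone is x_j^2 = c with c equal to
    d^2 / (1 - d^2) times the sum of the other squares.  The index i != j
    ensures that this c is not the zero polynomial. *)
Lemma cone_poly_dvd {R : rcfType} {k : nat} {i j : 'I_k} {d : R}
    {p : {mpoly R[k]}} :
  i != j -> d != 0 -> d ^+ 2 < 1 ->
  (forall v, v j ^+ 2 = d ^+ 2 * \sum_i v i ^+ 2 -> p.@[v] = 0) ->
  exists Q, p = Q * ('X_j ^+ 2 - d ^+ 2 *: \sum_(i < k) 'X_i ^+ 2).
Proof.
move=> ij d0; rewrite -subr_gt0 => d2 p0.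
pose c : {mpoly R[k]} :=
  (d ^+ 2 / (1 - d ^+ 2)) *: \sum_(i < k | i != j) 'X_i ^+ 2.
have cE v : c.@[v] = d ^+ 2 / (1 - d ^+ 2) * \sum_(i < k | i != j) v i ^+ 2.
  by rewrite mevalZ meval_sum_sqr.
have [|||v vc|Q pQ] := @monic_quadratic_dvd _ _ j c p.
- by move=> v w vw; rewrite !cE; congr (_ * _); apply: eq_bigr => l /vw ->.
- apply/eqP => /(congr1 (meval (fun=> 1))); rewrite cE meval0 => /eqP.
  apply/negP; rewrite gt_eqF// mulr_gt0 ?divr_gt0 ?exprn_even_gt0//.
  by rewrite (bigD1 i)//= expr1n ltr_wpDr// sumr_ge0// => l _; exact: sqr_ge0.
- move=> v; rewrite cE mulr_ge0 ?divr_ge0 ?sqr_ge0 ?(ltW d2)//.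
  by rewrite sumr_ge0// => l _; exact: sqr_ge0.
- apply: p0; rewrite (bigD1 j)//= mulrDr vc cE.
  by field; rewrite gt_eqF.
exists ((1 - d ^+ 2)^-1 *: Q); rewrite [in RHS](bigD1 j)//=.
have -> : 'X_j ^+ 2 - d ^+ 2 *: ('X_j ^+ 2 + \sum_(i < k | i != j) 'X_i ^+ 2) =
    (1 - d ^+ 2) *: ('X_j ^+ 2 - c) :> {mpoly R[k]}.
  rewrite /c scalerBr scalerA scalerDr mulrC divfK ?gt_eqF//.
  by rewrite scalerBl scale1r opprD addrA.
by rewrite -scalerAr -scalerAl scalerA divff ?gt_eqF// scale1r.
Qed.

Theorem proposition5p5 (R : realType) (n m : nat)
    (P : 'I_n.+1 -> {mpoly R[n.+1]}) (j : 'I_n.+1) (d : R) :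
  (2 <= n)%N -> (3 <= m)%N ->
  vf_homogeneous P -> vf_deg P = m -> vf_on_sphere P ->
  0 < `|d| -> `|d| < 1 ->
  vf_invariant P ([set x : 'rV[R]_n.+1 | x ord0 j + d = 0] `&` unit_sphere) ->
  exists B : 'I_n.+1 -> {mpoly R[n.+1]},
    (forall i : 'I_n.+1, i != j -> (mpoly_deg (B i) <= m - 3)%N) /\
    P j = (\sum_(i < n.+1 | i != j) B i * 'X_i) *
          ('X_j ^+ 2 - d ^+ 2 *: \sum_(i < n.+1) 'X_i ^+ 2).
Proof.
move=> n2 m3 [e Pe] Pdeg Psphere d0 d1 Pinv.
have e0 : (0 < e)%N.
  suff : (m <= e)%N by apply: leq_trans; apply: leq_trans m3.
  rewrite -Pdeg; apply/bigmax_leqP => i _; rewrite /mpoly_deg.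
  by have := msize_homog_le (Pe i); case: (msize (P i)).
have dn0 : d != 0 by rewrite -normr_gt0.
have d2 : d ^+ 2 < 1 by rewrite -real_normK ?num_real// expr_lt1.
have i0j : lift j (Ordinal n2) != j by rewrite eq_sym neq_lift.
have [|Q PQ] := cone_poly_dvd (p := P j) i0j dn0 d2.
  apply: (homog_vanishes_on_cone (Pe j) e0 dn0) => v vj v1.
  have Sj x : ([set x : 'rV[R]_n.+1 | x ord0 j + d = 0] `&` unit_sphere) x ->
      x ord0 j = - d by move=> [/= /eqP + _]; rewrite addr_eq0 => /eqP.
  have := invariant_hyperplane_section Pinv Sj (\row_i v i).
  rewrite (meval_eq (v2 := v)) => [->//|i]; last by rewrite mxE.
  split; rewrite /= /unit_sphere/= ?mxE ?vj ?addNr//.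
  by under eq_bigr do rewrite mxE.
set q : {mpoly R[n.+1]} := 'X_j ^+ 2 - d ^+ 2 *: _ in PQ *.
have [B [g [Bsize gj QE]]] := mpoly_mod_other_variables j Q.
pose ax (t : R) (i : 'I_n.+1) := if i == j then t else 0.
have axE t : \sum_i ax t i ^+ 2 = t ^+ 2.
  rewrite (bigD1 j)//= big1 => [|i /negPf ij]; last by rewrite /ax ij expr0n.
  by rewrite /ax eqxx addr0.
have qax t : q.@[ax t] = (1 - d ^+ 2) * t ^+ 2.
  by rewrite mevalB mevalZ meval_sum_sqr axE mevalXUn /ax eqxx; ring.
have Pax t : (P j).@[ax t] = 0.
  rewrite (meval_eq (v2 := fun i => t * ax 1 i)) => [|i]; last first.
    by rewrite /ax; case: eqP; rewrite ?mulr1 ?mulr0.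
  rewrite (meval_homog_scale _ _ (Pe j)).
  have := vf_on_sphere_tangent Psphere (ax 1); rewrite axE expr1n => /(_ erefl).
  rewrite (bigD1 j)//= big1 => [|i /negPf ij]; last by rewrite {2}/ax ij mulr0.
  by rewrite {2}/ax eqxx addr0 mulr1 => ->; rewrite mulr0.
(* On the j-th axis Q takes the values of g, and P j = Q * q gives
   g * (1 - d ^+ 2) * t ^+ 2 = 0; the factor t ^+ 2 is kept, as 'X_j ^+ 2, to
   treat the origin together with the other points. *)
have g0 : g = 0.
  suff /eqP : g * 'X_j ^+ 2 = 0.
    rewrite mulf_eq0 => /orP[/eqP //|/eqP /(congr1 (meval (fun=> 1)))].
    by rewrite mevalXUn meval0 expr1n => /eqP; rewrite oner_eq0.
  apply: mpoly_eq0_meval => v; rewrite mevalM mevalXUn.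
  have := Pax (v j).
  rewrite PQ mevalM qax QE mevalD raddf_sum/= big1 => [|i /negPf ij]; last first.
    by rewrite mevalM mevalXU /ax ij mulr0.
  rewrite add0r (gj _ v) => [|]; last by rewrite /ax eqxx.
  by rewrite mulrCA => /eqP; rewrite mulf_eq0 subr_eq0 gt_eqF//= => /eqP.
exists B; split; last by rewrite PQ QE g0 addr0.
move=> i _; rewrite /mpoly_deg.
have Qsize : (msize Q <= m.-1)%N.
  have [->|Q0] := eqVneq Q 0; first by rewrite mmeasure0.
  have q0 : q != 0.
    apply/eqP => q0; have := qax 1; rewrite q0 meval0 expr1n mulr1 => /esym/eqP.
    by rewrite subr_eq0 gt_eqF.
  have qh : q \is 2.-homog.
    have Xh l : ('X_l ^+ 2 : {mpoly R[n.+1]}) \is 2.-homog.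
      rewrite -[2%N]mul1n; apply: dhomogMn.
      by rewrite dhomogX [X in X == _]mdeg1.
    by rewrite rpredB// rpredZ// rpred_sum.
  have q3 : msize q = 3.
    by rewrite mpolySpred// (dhomog_uniq q0 (dhomog_msize qh) qh).
  have : (mpoly_deg (P j) <= m)%N by rewrite -Pdeg; exact: leq_bigmax.
  by rewrite /mpoly_deg PQ msizeM// q3; move: (msize Q) => k; lia.
by move: (msize Q) (msize (B i)) (Bsize i) Qsize m3 => a b; lia.
Qed.
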